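(* Let $q\in(0,1]$ and let $n\ge 0$ be an integer. The triangular $q$-Bernstein polynomials of degree $n$ form a partition of unity, i.e., $$\sum_{i+j+k=n}B^n_{ijk}(u,v)=1,$$ where the sum ranges over all integers $i,j,k\ge 0$ with $i+j+k=n$.
   Context: For a real number $q>0$ and a natural number $r$, the $q$-integer is $[r]=1+q+\cdots+q^{r-1}$ (so $[r]=r$ if $q=1$, and $[0]=0$). The $q$-factorial is $[r]!=[r][r-1]\cdots[1]$ with $[0]!=1$. The $q$-binomial coefficient is $\genfrac{[}{]}{0pt}{}{i}{j}=\frac{[i]!}{[j]!\,[i-j]!}$ if $i\ge j\ge 0$, and $0$ otherwise. For an integer $n\ge 0$ and integers $i,j,k\ge 0$ with $i+j+k=n$, the triangular $q$-Bernstein polynomial is $$B^n_{ijk}(u,v)=\genfrac{[}{]}{0pt}{}{n}{k}\binom{i+j}{i}u^iv^j\prod_{s=0}^{k-1}(1-q^su-q^sv),$$ where an empty product equals $1$. The identity is one of polynomials in the real variables $u,v$. *)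

(* Defs.v *)
From mathcomp Require Import all_boot all_order all_algebra.
From mathcomp Require Import reals.

Set Implicit Arguments.
Unset Strict Implicit.
Unset Printing Implicit Defensive.

Import Order.TTheory GRing.Theory Num.Theory.
Local Open Scope ring_scope.

Definition qint (R : realType) (q : R) (r : nat) : R := \sum_(s < r) q ^+ s.

Definition qfact (R : realType) (q : R) (r : nat) : R :=
  \prod_(s < r) qint q s.+1.

Definition qbinom (R : realType) (q : R) (i j : nat) : R :=
  if (j <= i)%N then qfact q i / (qfact q j * qfact q (i - j)) else 0.

(* The index relation i + j + k = n is not built in: it is imposed where the
   polynomials are used. *)
Definition qbernstein (R : realType) (q : R) (n i j k : nat) (u v : R) : R :=
  qbinom q n k * 'C(i + j, i)%:R * u ^+ i * v ^+ j *
  \prod_(s < k) (1 - q ^+ s * u - q ^+ s * v).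

(* Main.v *)
Require Import Defs.
From mathcomp Require Import all_boot all_order all_algebra.
From mathcomp Require Import reals.
From mathcomp Require Import ring.

Set Implicit Arguments.
Unset Strict Implicit.
Unset Printing Implicit Defensive.

Import Order.TTheory GRing.Theory Num.Theory.
Local Open Scope ring_scope.

(* For fixed k, the sum over i + j = n - k is a binomial expansion of
   x ^ (n - k) with x = u + v, so the theorem is the univariate identity
   sum_k [n, k] x ^ (n - k) (1 - x) (1 - q x) ... (1 - q ^ (k - 1) x) = 1.
   It follows by induction on n from the rule
   [n + 1, k + 1] = [n, k] + q ^ (k + 1) [n, k + 1]: in degree n + 1, the term
   of index k in degree n gets multiplied by (1 - q ^ k x) + q ^ k x = 1. *)

Section QBinomial.
Variables (R : realType) (q : R).
Hypothesis q_gt0 : 0 < q.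

Lemma qintD m n : qint q (m + n) = qint q m + q ^+ m * qint q n.
Proof.
rewrite /qint big_split_ord /= mulr_sumr; congr (_ + _).
by apply: eq_bigr => i _; rewrite exprD.
Qed.

Lemma qint_gt0 n : 0 < qint q n.+1.
Proof.
rewrite /qint big_ord_recl expr0 ltr_pwDl ?ltr01 //.
by apply: sumr_ge0 => i _; apply/exprn_ge0/ltW.
Qed.

Lemma qfactS n : qfact q n.+1 = qfact q n * qint q n.+1.
Proof. by rewrite /qfact big_ord_recr. Qed.

Lemma qfact_neq0 n : qfact q n != 0.
Proof. by apply: lt0r_neq0; apply: prodr_gt0 => i _; apply: qint_gt0. Qed.

Lemma qbinom0 n : qbinom q n 0 = 1.
Proof.
by rewrite /qbinom leq0n subn0 {2}/qfact big_ord0 mul1r divff ?qfact_neq0.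
Qed.

Lemma qbinom_small n k : (n < k)%N -> qbinom q n k = 0.
Proof. by move=> ltnk; rewrite /qbinom leqNgt ltnk. Qed.

Lemma qbinomnn n : qbinom q n n = 1.
Proof.
by rewrite /qbinom leqnn subnn {3}/qfact big_ord0 mulr1 divff ?qfact_neq0.
Qed.

(** For [k < n], writing [n = k + 1 + m] removes truncated subtraction; after cancelling the nonzero
    factorials, what remains is [[k + m + 2] = [k + 1] + q ^ (k + 1) [m + 1]], an instance of
    [qintD]. *)
Lemma qbinomS n k :
  qbinom q n.+1 k.+1 = qbinom q n k + q ^+ k.+1 * qbinom q n k.+1.
Proof.
have [ltnk|ltkn|->] := ltngtP n k.
- by rewrite !qbinom_small ?mulr0 ?addr0 // ltnS ltnW.
- have [m ->] : exists m, n = (k.+1 + m)%N.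
    by exists (n - k.+1)%N; rewrite subnKC.
  rewrite /qbinom ltnS leq_addr addSn leqW ?leq_addr //.
  rewrite !subSS subSn ?leq_addr // !addKn !qfactS /=.
  have -> : qint q (k + m).+2 = qint q k.+1 + q ^+ k.+1 * qint q m.+1.
    by rewrite -qintD addSn addnS.
  have := (qfact_neq0 k, qfact_neq0 m, lt0r_neq0 (qint_gt0 k),
           lt0r_neq0 (qint_gt0 m)).
  by move=> [[[hk hm] hik] him]; field; rewrite hk hm hik him.
- by rewrite !qbinomnn qbinom_small // mulr0 addr0.
Qed.

Lemma sum_qbinom_qpochhammer n (x : R) :
  \sum_(k < n.+1) qbinom q n k * x ^+ (n - k) * \prod_(s < k) (1 - q ^+ s * x)
  = 1.
Proof.
elim: n => [|n IHn].
  by rewrite big_ord1 qbinom0 big_ord0 !mulr1.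
pose P k := \prod_(s < k) (1 - q ^+ s * x).
(* Shift of the index by one: the left term at 0 is [x ^+ n.+1], and the right term at [k = n]
   vanishes because [[n, n + 1] = 0]. *)
have sum_shift : \sum_(k < n.+1) q ^+ k * qbinom q n k * x ^+ (n.+1 - k) * P k
    = x ^+ n.+1
      + \sum_(k < n.+1) q ^+ k.+1 * qbinom q n k.+1 * x ^+ (n - k) * P k.+1.
  rewrite [in LHS]big_ord_recl [in RHS]big_ord_recr /=.
  rewrite qbinom0 /P big_ord0 qbinom_small //.
  by rewrite !(mulr0, mul0r, addr0, mulr1) mul1r.
rewrite big_ord_recl qbinom0 big_ord0 mul1r mulr1 subn0.
under eq_bigr do rewrite lift0 subSS qbinomS !mulrDl.
(* The isolated [x ^+ n.+1] and the [q ^+ k.+1] half of the recurrence form the right side of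
   [sum_shift]; both sums then run over the same [[n, k]]. *)
rewrite big_split /= addrCA -sum_shift -big_split /= -[RHS]IHn.
apply: eq_bigr => k _; have lekn : (k <= n)%N by rewrite -ltnS.
rewrite (subSn lekn) (exprS x (n - k)) big_ord_recr /= /P.
by move: (qbinom _ _ _) (x ^+ _) (\prod_(s < k) _) (q ^+ k) => b y p t; ring.
Qed.

End QBinomial.

(** The bound [n] may exceed [m], to match the index ranges of the theorem: [i <= m] leaves only
    [j = m - i], and [i > m] leaves no [j]. *)
Lemma exprDn_antidiagonal (R : comNzRingType) (u v : R) (m n : nat) :
  (m <= n)%N ->
  \sum_(i < n.+1) \sum_(j < n.+1 | (i + j == m)%N)
    'C(i + j, i)%:R * u ^+ i * v ^+ j = (u + v) ^+ m.
Proof.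
(* [exprDn] gives the summation index as exponent to the second summand, hence the swap that puts
   [u] there. *)
move=> lemn; rewrite addrC exprDn.
rewrite (big_ord_widen n.+1 (fun i => (v ^+ (m - i) * u ^+ i) *+ 'C(m, i))) //.
rewrite [RHS]big_mkcond; apply: eq_bigr => i _; rewrite ltnS.
case: leqP => [leim|ltmi]; last first.
  by rewrite big_pred0 // => j; apply/negbTE; rewrite gtn_eqF // ltn_addr.
have ltmin : (m - i < n.+1)%N by rewrite ltnS (leq_trans (leq_subr _ _)).
rewrite (big_pred1 (Ordinal ltmin)) => [|j]; last first.
  by rewrite /= -val_eqE /= -(eqn_add2l i (j : nat)) subnKC.
by rewrite /= subnKC // -mulrA mulr_natl [u ^+ _ * _]mulrC.
Qed.

Theorem corollary4p3 (R : realType) (q : R) (n : nat)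
    (hq0 : 0 < q) (hq1 : q <= 1) (u v : R) :
  \sum_(i < n.+1) \sum_(j < n.+1) \sum_(k < n.+1 | (i + j + k == n)%N)
    qbernstein q n i j k u v = 1.
Proof.
rewrite -(sum_qbinom_qpochhammer hq0 n (u + v)).
(* Two exchanges bring [k] outermost, with the constraint now on [j]; for fixed [k] it reads
   [i + j = n - k]. *)
under eq_bigr => i _ do rewrite (exchange_big_dep xpredT) //=.
rewrite exchange_big; apply: eq_bigr => k _ /=.
have lekn : (k <= n)%N by rewrite -ltnS.
rewrite -(exprDn_antidiagonal u v (leq_subr k n)) mulr_sumr mulr_suml.
apply: eq_bigr => i _; rewrite mulr_sumr mulr_suml.
apply: eq_big => [j|j _]; first by rewrite -(eqn_add2r k (i + j)) subnK.
rewrite /qbernstein !mulrA; congr (_ * _).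
by apply: eq_bigr => s _; rewrite mulrDr opprD addrA.
Qed.
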